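(* The following two statements are equivalent: (a) For every $f\in\mathrm{Imm}(M,N)$ the splitting into vertical and horizontal parts $T_f\mathrm{Imm}(M,N)=\mathrm{Ver}_f\oplus\mathrm{Hor}_f$ exists (i.e. the sum $\mathrm{Ver}_f\oplus \mathrm{Hor}_f$ is all of $T_f\mathrm{Imm}(M,N)$), and it coincides with the splitting into tangential and normal parts $T_f\mathrm{Imm}(M,N)=\mathrm{Tan}_f\oplus\mathrm{Nor}_f$ (i.e. $\mathrm{Ver}_f=\mathrm{Tan}_f$ and $\mathrm{Hor}_f=\mathrm{Nor}_f$). (b) The operator $L$ has a decomposition $L=L^{\mathrm{Nor}}\oplus L^{\mathrm{Tan}}$ into operators $L^{\mathrm{Nor}}:\mathrm{Nor}\to\mathrm{Nor}$ and $L^{\mathrm{Tan}}:\mathrm{Tan}\to\mathrm{Tan}$.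
   Context: $M$ is a compact $m$-dimensional manifold and $(N,\overline g)$ is an $n$-dimensional Riemannian manifold of bounded geometry, $n\ge m$. $\mathrm{Imm}(M,N)$ is the Fréchet manifold of smooth immersions $M\to N$; its tangent space at $f$ is $T_f\mathrm{Imm}(M,N)=\{h\in C^\infty(M,TN):\pi_N\circ h=f\}$, where $\pi_N:TN\to N$ is the foot point projection. For $f\in\mathrm{Imm}(M,N)$, $g=f^*\overline g$ is the pullback metric on $M$ and $\mathrm{vol}(g)$ its volume form (density). $\mathrm{Diff}(M)$ is the group of smooth diffeomorphisms of $M$, acting on $\mathrm{Imm}(M,N)$ by $(f,\varphi)\mapsto f\circ\varphi$. The $L^2$-metric is $G^{L^2}_f(h,k)=\int_M\overline g(h,k)\,\mathrm{vol}(g)$. Standing assumptions on $L$: $L$ is a smooth bundle automorphism of $T\mathrm{Imm}(M,N)$ such that at every $f$ the operator $L_f:T_f\mathrm{Imm}(M,N)\to T_f\mathrm{Imm}(M,N)$ is a pseudo-differential operator of order $2l$ which is symmetric and positive with respect to the $L^2$-metric; moreover $L_{f\circ\varphi}(h\circ\varphi)=L_f(h)\circ\varphi$ for all $\varphi\in\mathrm{Diff}(M)$. The associated metric is $G^L_f(h,k)=\int_M\overline g(L_fh,k)\,\mathrm{vol}(g)$. Bundles: $\mathrm{Tan}_f=\{Tf\circ X: X\in\mathfrak X(M)\}$ with $\mathfrak X(M)$ the smooth vector fields on $M$; $\mathrm{Nor}_f=\{h\in T_f\mathrm{Imm}(M,N): \overline g(h,k)=0\ \forall k\in\mathrm{Tan}_f\}$.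 The vertical bundle (the kernel of the differential of the projection $\mathrm{Imm}(M,N)\to\mathrm{Imm}(M,N)/\mathrm{Diff}(M)$) is $\mathrm{Ver}_f=\mathrm{Tan}_f$, and the horizontal bundle is its $G^L$-orthogonal complement $\mathrm{Hor}_f=(\mathrm{Ver}_f)^{\perp,G^L}=\{h\in T_f\mathrm{Imm}(M,N): L_fh\in\mathrm{Nor}_f\}$. The sum $\mathrm{Tan}_f\oplus\mathrm{Nor}_f$ is always all of $T_f\mathrm{Imm}(M,N)$. *)

(* Defs.v *)
From HB Require Import structures.
From mathcomp Require Import all_boot all_order all_algebra.
From mathcomp Require Import all_classical all_reals all_analysis.
From mathcomp Require Import complex.
Set Implicit Arguments.
Unset Strict Implicit.
Unset Printing Implicit Defensive.
Import Order.TTheory GRing.Theory Num.Theory.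
Import numFieldNormedType.Exports.
Local Open Scope classical_set_scope.
Local Open Scope ring_scope.

(* Meaningful for open U; all spaces of interest are finite dimensional, so
   continuity of x |-> 'd f x v for every v is continuity of x |-> 'd f x. *)
Fixpoint Ck_on (R : realType) (V W : normedModType R) (k : nat)
    (U : set V) (f : V -> W) : Prop :=
  match k with
  | 0 => forall x, U x -> {for x, continuous f}
  | k'.+1 => (forall x, U x -> differentiable f x) /\
             (forall v, Ck_on k' U (fun x => 'd f x v))
  end.

Definition smooth_on (R : realType) (V W : normedModType R)
    (U : set V) (f : V -> W) : Prop :=
  forall k, Ck_on k U f.

Definition supported_in (R : realType) (m : nat) (W : zmodType)
    (U : set 'rV[R]_m) (u : 'rV[R]_m -> W) : Prop :=
  exists K : set 'rV[R]_m,
    [/\ compact K, K `<=` U & forall y, ~ K y -> u y = 0].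

Definition basis_vec (R : realType) (n : nat) (i : 'I_n) : 'rV[R]_n :=
  delta_mx 0 i.

Definition pderiv (R : realType) (n : nat) (i : 'I_n) (F : 'rV[R]_n -> R)
  : 'rV[R]_n -> R := fun y => 'D_(basis_vec R i) F y.

(* The Lebesgue integral over R^m, as an iterated integral: by Tonelli/Fubini
   this is the m-dimensional Lebesgue integral of F whenever F is Borel and
   either nonnegative or integrable. *)
Fixpoint lebint (R : realType) (m : nat) : ('rV[R]_m -> \bar R) -> \bar R :=
  match m with
  | 0 => fun F => F 0
  | m'.+1 => fun F =>
      (\int[@lebesgue_measure R]_t
         lebint (fun y : 'rV[R]_m' => F (row_mx (const_mx t : 'rV_1) y)))%E
  end.

Definition rint (R : realType) (m : nat) (F : 'rV[R]_m -> R) : R :=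
  fine (lebint (fun y => (F y)%:E)).

Definition cint (R : realType) (m : nat) (F : 'rV[R]_m -> R[i]) : R[i] :=
  Complex (rint (fun y => complex.Re (F y))) (rint (fun y => complex.Im (F y))).

Record chart (R : realType) (m : nat) (M : topologicalType) := Chart {
  dom : set M;
  cod : set 'rV[R]_m;
  cmap : M -> 'rV[R]_m;
  cinv : 'rV[R]_m -> M;
  dom_open : open dom;
  cod_open : open cod;
  cmap_cod : forall x, dom x -> cod (cmap x);
  cinv_dom : forall y, cod y -> dom (cinv y);
  cmapK : forall x, dom x -> cinv (cmap x) = x;
  cinvK : forall y, cod y -> cmap (cinv y) = y;
  cmap_cont : forall x, dom x -> {for x, continuous cmap};
  cinv_cont : forall y, cod y -> {for y, continuous cinv} }.

Definition smooth_transition (R : realType) (m : nat) (M : topologicalType)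
    (c d : chart R m M) : Prop :=
  smooth_on [set y | cod c y /\ dom d (cinv c y)] (fun y => cmap d (cinv c y)).

(* Nonempty manifolds without boundary, with their maximal smooth atlas. Chart
   domains need not be connected. *)
Record manifold (R : realType) (m : nat) := Manifold {
  carrier :> ptopologicalType;
  atlas : set (chart R m carrier);
  manifold_hausdorff : hausdorff_space carrier;
  manifold_second_countable : @second_countable carrier;
  atlas_cover : forall x, exists c, atlas c /\ dom c x;
  atlas_smooth : forall c d, atlas c -> atlas d -> smooth_transition c d;
  atlas_maximal : forall c,
    (forall d, atlas d -> smooth_transition c d /\ smooth_transition d c) ->
    atlas c }.

Definition atlas_at (R : realType) (m : nat) (M : manifold R m) (x : M)
    (c : chart R m M) : Prop := atlas c /\ dom c x.

Definition chart_at (R : realType) (m : nat) (M : manifold R m) (x : M)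
  : chart R m M := sval (cid (atlas_cover x)).

(* A tangent vector is the family of its components in all the charts, which
   transforms by the differentials of the transition maps; the components are
   set to 0 in the charts which do not contain the foot point. *)
Definition tvec (R : realType) (m : nat) (M : manifold R m) : Type :=
  chart R m M -> 'rV[R]_m.

Definition tspace (R : realType) (m : nat) (M : manifold R m) (x : M)
  : set (tvec M) :=
  [set v | (forall c, ~ atlas_at x c -> v c = 0) /\
           (forall c d, atlas_at x c -> atlas_at x d ->
              v d = 'd (fun y => cmap d (cinv c y)) (cmap c x) (v c))].

(* The tangent vector at x whose component in the chart c (around x) is u. *)
Definition coord_vec (R : realType) (m : nat) (M : manifold R m)
    (c : chart R m M) (x : M) (u : 'rV[R]_m) : tvec M :=
  fun d => if `[< atlas_at x d >]
           then 'd (fun y => cmap d (cinv c y)) (cmap c x) u else 0.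

Section Maps.
Variables (R : realType) (m n : nat) (M : manifold R m) (N : manifold R n).

(* The part of the chart c of M sent by f to the chart d of N. *)
Definition chart_cap (f : M -> N) (c : chart R m M) (d : chart R n N)
  : set 'rV[R]_m := [set y | cod c y /\ dom d (f (cinv c y))].

Definition smooth_map (f : M -> N) : Prop :=
  continuous f /\
  forall c d, atlas c -> atlas d ->
    smooth_on (chart_cap f c d) (fun y => cmap d (f (cinv c y))).

Definition tmap (f : M -> N) (x : M) (v : tvec M) : tvec N :=
  fun d => if `[< atlas_at (f x) d >]
           then 'd (fun y => cmap d (f (cinv (chart_at x) y)))
                   (cmap (chart_at x) x) (v (chart_at x))
           else 0.

Definition immersion (f : M -> N) : Prop :=
  smooth_map f /\ forall x, set_inj (tspace x) (tmap f x).

(* For smooth f, the space of smooth h : M -> TN with foot point map f. *)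
Definition smooth_along (f : M -> N) : set (M -> tvec N) :=
  [set h | (forall x, tspace (f x) (h x)) /\
           (forall c d, atlas c -> atlas d ->
              smooth_on (chart_cap f c d) (fun y => h (cinv c y) d))].

End Maps.

Definition vector_fields (R : realType) (m : nat) (M : manifold R m)
  : set (M -> tvec M) := smooth_along idfun.

Definition diffeomorphism (R : realType) (m : nat) (M : manifold R m)
    (phi : M -> M) : Prop :=
  smooth_map phi /\
  exists psi : M -> M, [/\ smooth_map psi, cancel phi psi & cancel psi phi].

Definition gram (R : realType) (m : nat) (M : manifold R m)
    (B : M -> tvec M -> tvec M -> R) (c : chart R m M) (y : 'rV[R]_m)
  : 'M[R]_m :=
  \matrix_(i, j) B (cinv c y) (coord_vec c (cinv c y) (basis_vec R i))
                              (coord_vec c (cinv c y) (basis_vec R j)).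

(* The values of metric x outside tspace x are irrelevant. *)
Record riemannian_metric (R : realType) (n : nat) (N : manifold R n) :=
  RiemannianMetric {
  metric :> N -> tvec N -> tvec N -> R;
  metric_sym : forall x u v, tspace x u -> tspace x v ->
    metric x u v = metric x v u;
  metric_linear : forall x a u v w,
    tspace x u -> tspace x v -> tspace x w ->
    metric x (a *: u + v) w = a * metric x u w + metric x v w;
  metric_pos : forall x u, tspace x u -> u <> 0 -> 0 < metric x u u;
  metric_smooth : forall c i j, atlas c ->
    smooth_on (cod c) (fun y => gram metric c y i j : R^o) }.

Definition pullback (R : realType) (m n : nat) (M : manifold R m)
    (N : manifold R n) (gbar : riemannian_metric N) (f : M -> N)
  : M -> tvec M -> tvec M -> R :=
  fun x u v => gbar (f x) (tmap f x u) (tmap f x v).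

Definition borel (R : realType) (m : nat) (M : manifold R m) :=
  g_sigma_algebraType (@open M).

(* mu = vol(g), the (unique) Borel measure which in every chart has density
   sqrt (det g_ij) with respect to the Lebesgue measure. *)
Definition is_volume (R : realType) (m : nat) (M : manifold R m)
    (g : M -> tvec M -> tvec M -> R)
    (mu : {measure set (borel M) -> \bar R}) : Prop :=
  forall c (A : set (borel M)), atlas c -> measurable A -> A `<=` dom c ->
    mu A = lebint (fun y : 'rV[R]_m =>
      (\1_[set z | cod c z /\ A (cinv c z)] y
         * Num.sqrt (\det (gram g c y)))%:E).

Section BoundedGeometry.
Variables (R : realType) (n : nat) (N : manifold R n).
Variables (gbar : riemannian_metric N) (c : chart R n N).

Let g := gram gbar c.

(* Gamma^k_ij in the chart c *)
Definition christoffel (k i j : 'I_n) (y : 'rV[R]_n) : R :=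
  2^-1 * \sum_l invmx (g y) k l *
    (pderiv i (fun z => g z j l) y + pderiv j (fun z => g z i l) y
     - pderiv l (fun z => g z i j) y).

(* the d_s-component of R(d_i, d_j) d_k *)
Definition curvature (s k i j : 'I_n) (y : 'rV[R]_n) : R :=
  pderiv i (christoffel s j k) y - pderiv j (christoffel s i k) y
  + \sum_t (christoffel s i t y * christoffel t j k y
            - christoffel s j t y * christoffel t i k y).

(* Covariant tensors in the chart c are given by their components, indexed by
   the sequence of the lower indices. *)
Definition riemann (I : seq 'I_n) (y : 'rV[R]_n) : R :=
  if I is [:: i; j; k; l] then \sum_s g y l s * curvature s k i j y else 0.

(* (nabla T)_{k J} = d_k T_J - sum_s sum_l Gamma^l_{k J_s} T_{J with J_s := l} *)
Definition covariant_derivative (T : seq 'I_n -> 'rV[R]_n -> R)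
    (I : seq 'I_n) (y : 'rV[R]_n) : R :=
  if I is k :: J then
    pderiv k (T J) y
    - \sum_(s < size J) \sum_l
        christoffel l k (nth k J s) y * T (set_nth k J s l) y
  else 0.

(* |T|_g^2 for a tensor of rank r *)
Definition tensor_sqnorm (r : nat) (T : seq 'I_n -> 'rV[R]_n -> R)
    (y : 'rV[R]_n) : R :=
  \sum_(I : r.-tuple 'I_n) \sum_(J : r.-tuple 'I_n)
    (\prod_(s < r) invmx (g y) (tnth I s) (tnth J s)) * (T I y * T J y).

(* The inverse of the chart c is exp_p, in some orthonormal basis of the tangent
   space at p, restricted to the ball of radius r: it is a diffeomorphism of
   that ball onto an open subset, and the straight lines through the origin are
   geodesics, with initial velocity the given vector. *)
Definition is_normal_chart (p : N) (r : R) : Prop :=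
  [/\ atlas_at p c, cmap c p = 0,
      cod c = [set v : 'rV[R]_n | \sum_i v 0 i ^+ 2 < r ^+ 2],
      g 0 = 1%:M
    & forall (v : 'rV[R]_n) (t : R), cod c (t *: v) -> forall k,
        \sum_i \sum_j christoffel k i j (t *: v) * v 0 i * v 0 j = 0].

End BoundedGeometry.

(* Positive injectivity radius, and every iterated covariant derivative of the
   curvature is bounded. *)
Definition bounded_geometry (R : realType) (n : nat) (N : manifold R n)
    (gbar : riemannian_metric N) : Prop :=
  (exists r : R, 0 < r /\
     forall p : N, exists c, is_normal_chart gbar c p r) /\
  (forall k : nat, exists C : R, forall c (y : 'rV[R]_n), atlas c -> cod c y ->
     tensor_sqnorm gbar c (4 + k)
       (iter k (covariant_derivative gbar c) (riemann gbar c)) y <= C).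

Section Pseudodifferential.
Variables (R : realType) (m n : nat).

Definition dot (x y : 'rV[R]_m) : R := \sum_i x 0 i * y 0 i.

Definition cis (t : R) : R[i] := Complex (cos t) (sin t).

Definition fourier (u : 'rV[R]_m -> 'rV[R]_n) (xi : 'rV[R]_m) : 'rV[R[i]]_n :=
  \row_j cint (fun y => cis (- dot y xi) * Complex (u y 0 j) 0).

Definition iter_deriv (vs : seq ('rV[R]_m * 'rV[R]_m))
    (b : 'rV[R]_m * 'rV[R]_m -> R) : 'rV[R]_m * 'rV[R]_m -> R :=
  foldr (fun v F z => 'D_v F z) b vs.

(* The symbol class S^mu(R^m x R^m); the multi-indices are given as sequences of
   directions of differentiation. *)
Definition symbol_class (mu : R) (b : 'rV[R]_m * 'rV[R]_m -> R) : Prop :=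
  smooth_on setT (b : _ -> R^o) /\
  forall alpha beta : seq 'I_m, exists C : R, forall x xi : 'rV[R]_m,
    `| iter_deriv ([seq (basis_vec R i, 0) | i <- alpha]
                     ++ [seq (0, basis_vec R j) | j <- beta]) b (x, xi) |
    <= C * (1 + `|xi|) `^ (mu - (size beta)%:R).

Definition matrix_symbol (mu : R) (a : 'rV[R]_m * 'rV[R]_m -> 'M[R[i]]_n)
  : Prop :=
  forall i j, symbol_class mu (fun z => complex.Re (a z i j)) /\
              symbol_class mu (fun z => complex.Im (a z i j)).

(* (2 pi)^-m int e^(i <x, xi>) a(x, xi) u^(xi) d xi, with a acting on row
   vectors *)
Definition quantization (a : 'rV[R]_m * 'rV[R]_m -> 'M[R[i]]_n)
    (u : 'rV[R]_m -> 'rV[R]_n) (x : 'rV[R]_m) : 'rV[R[i]]_n :=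
  \row_j (Complex ((2 * pi) ^- m) 0 *
    cint (fun xi => cis (dot x xi) * (fourier u xi *m a (x, xi)) 0 j)).

Variables (M : manifold R m) (N : manifold R n).

Definition local_section (f : M -> N) (c : chart R m M) (d : chart R n N)
    (w : 'rV[R]_m -> 'rV[R]_n) : M -> tvec N :=
  fun x => if `[< dom c x /\ dom d (f x) >]
           then coord_vec d (f x) (w (cmap c x)) else 0.

(* A acts on the sections of f^*TN. As in Hoermander's definition, the localized
   operators u |-> chi1 A (chi2 u) are required to be quantizations of symbols
   in all the charts; disconnected charts take care of the smoothness of the
   Schwartz kernel off the diagonal. *)
Definition pseudo_differential (mu : R) (f : M -> N)
    (A : (M -> tvec N) -> (M -> tvec N)) : Prop :=
  forall c d, atlas c -> atlas d ->
  forall chi1 chi2 : 'rV[R]_m -> R^o,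
    smooth_on setT chi1 -> supported_in (chart_cap f c d) chi1 ->
    smooth_on setT chi2 -> supported_in (chart_cap f c d) chi2 ->
  exists a, matrix_symbol mu a /\
  forall u : 'rV[R]_m -> 'rV[R]_n, smooth_on setT u -> supported_in setT u ->
  forall (y : 'rV[R]_m) (j : 'I_n),
    Complex (chi1 y *
      A (local_section f c d (fun z => chi2 z *: u z)) (cinv c y) d 0 j) 0
    = quantization a u y 0 j.

End Pseudodifferential.

Section Immersions.
Variables (R : realType) (m n : nat) (M : manifold R m) (N : manifold R n).

(* A fiberwise map of T Imm(M, N); only its values L f h for f an immersion and
   h along f are relevant. *)
Definition fiber_map : Type := (M -> N) -> (M -> tvec N) -> (M -> tvec N).

Definition linear_operator_on (S : set (M -> tvec N))
    (A : (M -> tvec N) -> (M -> tvec N)) : Prop :=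
  (forall h, S h -> S (A h)) /\
  (forall (a : R) h k, S h -> S k -> A (a *: h + k) = a *: A h + A k).

(* A smooth curve t |-> h t in T Imm(M, N) over the curve t |-> f t: smooth
   curves in spaces of smooth maps on M are smooth maps on R x M. *)
Definition smooth_curve (f : R -> M -> N) (h : R -> M -> tvec N) : Prop :=
  [/\ forall t, immersion (f t) /\ smooth_along (f t) (h t),
      continuous (fun z : R * M => f z.1 z.2)
    & forall c d, atlas c -> atlas d ->
        let U := [set z : R^o * 'rV[R]_m | chart_cap (f z.1) c d z.2] in
        smooth_on U (fun z => cmap d (f z.1 (cinv c z.2))) /\
        smooth_on U (fun z => h z.1 (cinv c z.2) d)].

(* Smoothness is that of convenient calculus, smooth curves are mapped to smooth
   curves; between Frechet manifolds it is the usual notion. *)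
Definition smooth_bundle_map (L : fiber_map) : Prop :=
  (forall f, immersion f -> linear_operator_on (smooth_along f) (L f)) /\
  (forall f h, smooth_curve f h -> smooth_curve f (fun t => L (f t) (h t))).

Definition smooth_bundle_automorphism (L : fiber_map) : Prop :=
  smooth_bundle_map L /\
  exists L' : fiber_map, smooth_bundle_map L' /\
    forall f h, immersion f -> smooth_along f h ->
      L' f (L f h) = h /\ L f (L' f h) = h.

Variable gbar : riemannian_metric N.
(* vol f is meant to be vol(f^* gbar). *)
Variable vol : (M -> N) -> {measure set (borel M) -> \bar R}.
Variable L : fiber_map.

Definition GL2 (f : M -> N) (h k : M -> tvec N) : R :=
  (\int[vol f]_x gbar (f x) (h x) (k x))%R.

Definition GL (f : M -> N) (h k : M -> tvec N) : R := GL2 f (L f h) k.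

Definition L2_symmetric : Prop :=
  forall f h k, immersion f -> smooth_along f h -> smooth_along f k ->
    GL2 f (L f h) k = GL2 f h (L f k).

Definition L2_positive : Prop :=
  forall f h, immersion f -> smooth_along f h -> h <> 0 -> 0 < GL2 f (L f h) h.

Definition Diff_equivariant : Prop :=
  forall f phi h, immersion f -> diffeomorphism phi -> smooth_along f h ->
    L (f \o phi) (h \o phi) = L f h \o phi.

Definition Tan (f : M -> N) : set (M -> tvec N) :=
  [set (fun x => tmap f x (X x)) | X in @vector_fields R m M].

Definition Nor (f : M -> N) : set (M -> tvec N) :=
  [set h | smooth_along f h /\
           forall k, Tan f k -> forall x, gbar (f x) (h x) (k x) = 0].

Definition Ver (f : M -> N) : set (M -> tvec N) := Tan f.

Definition Hor (f : M -> N) : set (M -> tvec N) :=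
  [set h | smooth_along f h /\ forall k, Ver f k -> GL f h k = 0].

Definition direct_sum (T A B : set (M -> tvec N)) : Prop :=
  T = [set h + k | h in A & k in B] /\ A `&` B = [set 0].

(* L = LNor (+) LTan over every immersion *)
Definition decomposes (LNor LTan : fiber_map) : Prop :=
  forall f, immersion f ->
    [/\ linear_operator_on (Nor f) (LNor f),
        linear_operator_on (Tan f) (LTan f)
      & forall h k, Nor f h -> Tan f k ->
          L f (h + k) = LNor f h + LTan f k].

End Immersions.

(* Main.v *)
(* Every field h along an immersion f splits as h = Tf o X + k with k normal: in
   a chart, the coordinates of X are those of the tangential component of h,
   obtained by applying the inverse of the Gram matrix of f^* gbar to the row of
   the gbar(h, d_j f), hence they are smooth, and X does not depend on the chart
   because f^* gbar is definite.

   If L preserves Tan and Nor, then Nor is contained in Hor since the integrands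
   vanish; and if h = a + b is horizontal with a tangential and b normal, then
   0 = G^L(h, a) = G^L(a, a), so a = 0.
   Conversely, assume Hor = Nor, let h be normal and let L h = a + b. Writing
   L^-1 a = c + d with c tangential and d normal, one gets
   G^L(L^-1 a, L^-1 a) = <a, c + d> = <a + b, c> = G^L(h, c) = 0, so a = 0. For h
   tangential one shows b = 0 in the same way, by the symmetry of L. *)

Require Import Defs.
From HB Require Import structures.
From mathcomp Require Import all_boot all_order all_algebra.
From mathcomp Require Import all_classical all_reals all_analysis.
Set Implicit Arguments.
Unset Strict Implicit.
Unset Printing Implicit Defensive.
Import Order.TTheory GRing.Theory Num.Theory.
Import numFieldNormedType.Exports.
Local Open Scope classical_set_scope.
Local Open Scope ring_scope.

(** * Calculus of $C^k$ maps on open sets *)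

Section Calculus.
Variable R : realType.
Implicit Types V W : normedModType R.

(** Both maps have the same first-order expansion at [x], and the differential is unique. Chart
    identities hold only on open sets, so differentials have to be compared through germs. *)
Lemma is_diff_near V W (f g : V -> W) x :
  {near x, f =1 g} -> differentiable f x -> is_diff x g ('d f x).
Proof.
move=> fg df.
have gE : g \o shift x = cst (g x) + 'd f x +o_ 0 id.
  apply/eqaddoP => e e0.
  have /eqaddoP/(_ e e0) fe := diff_locally df.
  have fg0 : \forall y \near (0 : V), f (y + x) = g (y + x).
    have : \forall y \near x, f y = g y by [].
    rewrite (near_shift 0 x) subr0.
    by apply: filterS => y /=.
  apply: filterS2 fe fg0 => y; rewrite !fctE /= => + fgy.
  by rewrite fgy (nbhs_singleton fg).
have dE : 'd g x = 'd f x :> (V -> W) by exact: (diff_unique (diff_continuous df) gE).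
apply: DiffDef => //; apply/diff_locallyP; rewrite dE.
by split=> //; exact: diff_continuous.
Qed.

Lemma Ck_on_sub V W k (U U' : set V) (f : V -> W) :
  U' `<=` U -> Ck_on k U f -> Ck_on k U' f.
Proof.
move=> UU'; elim: k f => [|k IH] f /=; first by move=> cf x /UU'; exact: cf.
by move=> [df Cf]; split=> [x /UU'|v]; [exact: df | exact: IH].
Qed.

(** [Ck_on] imposes conditions point by point, with differentials taken in the ambient space, so the
    sets [U'] may be arbitrary. *)
Lemma Ck_on_local V W k (U : set V) (f : V -> W) :
  (forall x, U x -> exists2 U', U' x & Ck_on k U' f) -> Ck_on k U f.
Proof.
elim: k f => [|k IH] f H /=; first by move=> x /H[U' U'x]; exact.
split=> [x /H[U' U'x [df _]]|v]; first exact: df.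
by apply: IH => x /H[U' U'x [_ Cf]]; exists U' => //; exact: Cf.
Qed.

Lemma Ck_on_pred V W k (U : set V) (f : V -> W) :
  Ck_on k.+1 U f -> Ck_on k U f.
Proof.
elim: k f => [|k IH] f [df Cf].
  by move=> x /df; exact: differentiable_continuous.
by split=> // v; exact: IH.
Qed.

(** Openness turns agreement on [U] into agreement near each of its points, so the directional
    derivatives agree on [U] too and the induction goes on. Below, this replaces a map by a formula
    valid only on [U]. *)
Lemma Ck_on_eq V W k (U : set V) (f g : V -> W) : open U ->
  (forall x, U x -> f x = g x) -> Ck_on k U f -> Ck_on k U g.
Proof.
move=> oU; elim: k f g => [|k IH] f g fg /=.
  move=> cf x Ux; have fgx : {near x, f =1 g}.
    by apply: filterS (open_nbhs_nbhs (conj oU Ux)) => y /fg.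
  rewrite /prop_for /continuous_at -(fg _ Ux).
  by apply: cvg_trans (cf _ Ux); apply: near_eq_cvg.
move=> [df Cf].
have dg x : U x -> is_diff x g ('d f x).
  move=> Ux; apply: is_diff_near (df _ Ux).
  by apply: filterS (open_nbhs_nbhs (conj oU Ux)) => y /fg.
split=> [x Ux|v]; first by have [] := dg _ Ux.
by apply: (IH _ _ _ (Cf v)) => x Ux; have [_ ->] := dg _ Ux.
Qed.

Section OpenSet.
Variables (V : normedModType R) (U : set V).
Hypothesis openU : open U.

Lemma Ck_on_cst (W : normedModType R) k (w : W) : Ck_on k U (fun=> w).
Proof.
elim: k w => [|k IH] w /=; first by move=> x _; exact: cst_continuous.
split=> [x _|v]; first exact: differentiable_cst.
by apply: Ck_on_eq (IH 0) => // x _; rewrite (diff_cst w x).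
Qed.

Lemma Ck_onD (W : normedModType R) k (f g : V -> W) :
  Ck_on k U f -> Ck_on k U g -> Ck_on k U (fun x => f x + g x).
Proof.
elim: k f g => [|k IH] f g /=.
  by move=> cf cg x Ux; apply: continuousD; [exact: cf|exact: cg].
move=> [df Cf] [dg Cg]; split=> [x Ux|v].
  by apply: differentiableD; [exact: df|exact: dg].
apply: Ck_on_eq (IH _ _ (Cf v) (Cg v)) => // x Ux.
exact: (esym (congr1 (@^~ v) (diffD (df _ Ux) (dg _ Ux)))).
Qed.

Lemma Ck_onZ (W : normedModType R) k a (f : V -> W) :
  Ck_on k U f -> Ck_on k U (fun x => a *: f x).
Proof.
elim: k f => [|k IH] f /=.
  by move=> cf x Ux; apply: continuousZl_tmp; exact: cf.
move=> [df Cf]; split=> [x Ux|v].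
  by apply: (differentiableZ _ (df _ Ux)).
apply: Ck_on_eq (IH _ (Cf v)) => // x Ux.
exact: (esym (congr1 (@^~ v) (diffZ a (df _ Ux)))).
Qed.

Lemma Ck_on_sum (W : normedModType R) k (I : Type) (r : seq I) (P : pred I)
    (F : I -> V -> W) :
  (forall i, Ck_on k U (F i)) ->
  Ck_on k U (fun x => \sum_(i <- r | P i) F i x).
Proof.
move=> CF; elim: r => [|i r IH].
  by apply: Ck_on_eq (Ck_on_cst k (0 : W)) => // x _; rewrite big_nil.
apply: (@Ck_on_eq _ _ _ _ (fun x => (if P i then F i x else 0) +
   \sum_(i <- r | P i) F i x)) => // [x _|].
  by rewrite big_cons; case: ifP => // _; rewrite add0r.
by apply: Ck_onD => //; case: (P i); [exact: CF|exact: Ck_on_cst].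
Qed.

Lemma Ck_onZl (W : normedModType R) k (f : V -> R^o) (w : W) :
  Ck_on k U f -> Ck_on k U (fun x => f x *: w).
Proof.
elim: k f => [|k IH] f /=.
  move=> cf x Ux.
  exact: (continuous_comp (cf x Ux) (@scalel_continuous _ _ w (f x))).
move=> [df Cf]; split=> [x Ux|v].
  by apply: differentiableZl; exact: df.
apply: Ck_on_eq (IH _ (Cf v)) => // x Ux.
exact: (esym (congr1 (@^~ v) (diffZl w (df _ Ux)))).
Qed.

(** Leibniz rule: the derivative again contains the undifferentiated factors, whose order is lowered
    by [Ck_on_pred] before the induction hypothesis applies. *)
Lemma Ck_onM k (f g : V -> R^o) :
  Ck_on k U f -> Ck_on k U g -> Ck_on k U (fun x => f x * g x : R^o).
Proof.
elim: k f g => [|k IH] f g.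
  by move=> cf cg x Ux; apply: (@continuousM R V); [exact: cf|exact: cg].
move=> Cf Cg; have [df Cdf] := Cf; have [dg Cdg] := Cg; split=> [x Ux|v].
  by apply: differentiableM; [exact: df|exact: dg].
apply: (@Ck_on_eq _ _ _ _ (fun x => f x * 'd g x v + g x * 'd f x v : R^o)) => //.
  by move=> x Ux; exact: (esym (congr1 (@^~ v) (diffM (df _ Ux) (dg _ Ux)))).
exact: (Ck_onD (IH _ _ (Ck_on_pred Cf) (Cdg v)) (IH _ _ (Ck_on_pred Cg) (Cdf v))).
Qed.

Lemma Ck_on_prod k (I : Type) (r : seq I) (P : pred I) (F : I -> V -> R^o) :
  (forall i, Ck_on k U (F i)) ->
  Ck_on k U (fun x => \prod_(i <- r | P i) F i x : R^o).
Proof.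
move=> CF; elim: r => [|i r IH].
  by apply: Ck_on_eq (Ck_on_cst k (1 : R^o)) => // x _; rewrite big_nil.
apply: (@Ck_on_eq _ _ _ _ (fun x => (if P i then F i x else 1) *
   \prod_(i <- r | P i) F i x : R^o)) => // [x _|].
  by rewrite big_cons; case: ifP => // _; rewrite mul1r.
by apply: Ck_onM => //; case: (P i); [exact: CF|exact: Ck_on_cst].
Qed.

Lemma Ck_onV k (f : V -> R^o) : (forall x, U x -> f x != 0) ->
  Ck_on k U f -> Ck_on k U (fun x => (f x)^-1 : R^o).
Proof.
move=> f0; elim: k => [|k IH].
  by move=> cf x Ux; apply: continuousV; [exact: f0|exact: cf].
move=> Cf; have [df Cdf] := Cf; split=> [x Ux|v].
  by apply: differentiableV; [exact: df|exact: f0].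
have Ci := IH (Ck_on_pred Cf).
(* The derivative of $1/f$ is $-f^{-2}\,df$, where $1/f$ is already $C^k$ by the induction
   hypothesis [Ci]. *)
apply: (@Ck_on_eq _ _ _ _ (fun x => -1 * ((f x)^-1 * (f x)^-1 * 'd f x v) : R^o)) => //.
  move=> x Ux; rewrite mulN1r -invfM -expr2 -mulNr.
  exact: (esym (congr1 (@^~ v) (diffV (df _ Ux) (f0 _ Ux)))).
exact: (Ck_onM (Ck_on_cst _ (-1 : R^o)) (Ck_onM (Ck_onM Ci Ci) (Cdf v))).
Qed.

(** Taking an entry is a continuous linear map [c], hence commutes with differentiation. *)
Lemma Ck_on_coord k (p q : nat) (f : V -> 'M[R]_(p, q)) i j :
  Ck_on k U f -> Ck_on k U (fun x => f x i j : R^o).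
Proof.
elim: k f => [|k IH] f.
  move=> cf x Ux.
  exact: (continuous_comp (cf x Ux) (@coord_continuous _ _ _ i j (f x))).
move=> [df Cf].
have @c : {linear 'M[R]_(p, q) -> R^o}.
  by exists (fun N : 'M[R]_(_, _) => N i j); do 2![eexists]; do ?[constructor];
     rewrite ?mxE// => ? *; rewrite ?mxE//; move=> ?; rewrite !mxE.
have cc : continuous c by exact: coord_continuous.
split=> [x Ux|v].
  exact: (differentiable_comp (df _ Ux) (linear_differentiable (f x) cc)).
apply: Ck_on_eq (IH _ (Cf v)) => // x Ux.
have := diff_comp (df _ Ux) (linear_differentiable (f x) cc).
by move=> /(congr1 (@^~ v)) /=; rewrite (diff_lin _ cc).
Qed.

Lemma Ck_on_row k (q : nat) (f : V -> 'rV[R]_q) :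
  (forall j, Ck_on k U (fun x => f x 0 j : R^o)) -> Ck_on k U f.
Proof.
move=> Cf; apply: (@Ck_on_eq _ _ _ _ (fun x => \sum_j f x 0 j *: basis_vec R j)) => //.
  by move=> x _; rewrite [RHS]row_sum_delta.
by apply: Ck_on_sum => j; exact: Ck_onZl.
Qed.

Lemma Ck_on_det k (p : nat) (A : V -> 'M[R]_p) :
  (forall i j, Ck_on k U (fun x => A x i j : R^o)) ->
  Ck_on k U (fun x => \det (A x) : R^o).
Proof.
by move=> CA; apply: Ck_on_sum => s; apply: Ck_onM; [exact: Ck_on_cst|exact: Ck_on_prod].
Qed.

(** Cramer's rule: each entry is a cofactor divided by a determinant that does not vanish on [U]. *)
Lemma Ck_on_invmx k (p : nat) (A : V -> 'M[R]_p) i j :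
  (forall x, U x -> A x \in unitmx) ->
  (forall i j, Ck_on k U (fun x => A x i j : R^o)) ->
  Ck_on k U (fun x => invmx (A x) i j : R^o).
Proof.
move=> uA CA; apply: (@Ck_on_eq _ _ _ _ (fun x => (\det (A x))^-1 *
    ((-1) ^+ (j + i) * \det (row' j (col' i (A x)))) : R^o)) => //.
  by move=> x /uA uAx; rewrite /invmx uAx !mxE.
apply: Ck_onM.
  by apply: Ck_onV; [move=> x /uA; rewrite unitmxE unitfE|exact: Ck_on_det].
apply: (Ck_onM (Ck_on_cst _ _)); apply: Ck_on_det => i' j'.
by apply: Ck_on_eq (CA (lift j i') (lift i j')) => // x _; rewrite !mxE.
Qed.

End OpenSet.

Lemma diff_row (q : nat) W (f : 'rV[R]_q -> W) y v :
  'd f y v = \sum_i v 0 i *: 'd f y (basis_vec R i).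
Proof.
by rewrite {1}(row_sum_delta v) linear_sum; apply: eq_bigr => i _; rewrite linearZ.
Qed.

(** In the chain rule the direction $dF_x(v)$ varies with $x$, while [Ck_on] differentiates in
    constant directions. Expanding it in the standard basis leaves products of coordinates of
    $dF_x(v)$ with partial derivatives of [G] composed with [F], to which the induction applies. *)
Lemma Ck_on_comp V (p : nat) k (U : set V) (U' : set 'rV[R]_p)
    (F : V -> 'rV[R]_p) (G : 'rV[R]_p -> R^o) :
  open U -> (forall x, U x -> U' (F x)) ->
  Ck_on k U F -> Ck_on k U' G -> Ck_on k U (G \o F).
Proof.
move=> oU UU'; elim: k G => [|k IH] G.
  by move=> cF cG x Ux; apply: continuous_comp; [exact: cF|exact/cG/UU'].
move=> CF [dG CG]; have [dF CdF] := CF; split=> [x Ux|v].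
  by apply: differentiable_comp; [exact: dF|exact/dG/UU'].
apply: (@Ck_on_eq _ _ _ _ (fun x => \sum_i 'd F x v 0 i * 'd G (F x) (basis_vec R i) : R^o)) => //.
  move=> x Ux; have := diff_comp (dF _ Ux) (dG _ (UU' _ Ux)).
  move=> /(congr1 (@^~ v)) /= ->; rewrite [RHS]diff_row; exact: eq_bigr.
apply: Ck_on_sum => // i; apply: Ck_onM => //; first exact: (Ck_on_coord oU 0 i (CdF v)).
exact: (IH (fun y => 'd G y (basis_vec R i)) (Ck_on_pred CF) (CG _)).
Qed.

End Calculus.

(** Serves [coord_vec c x] and [tmap f x], which are linear but not declared as linear maps. *)
Lemma linear_fun_sum (K : nzRingType) (U W : lmodType K) (F : U -> W)
    (I : Type) (r : seq I) (a : I -> K) (u : I -> U) :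
  (forall b v w, F (b *: v + w) = b *: F v + F w) ->
  F (\sum_(i <- r) a i *: u i) = \sum_(i <- r) a i *: F (u i).
Proof.
move=> linF.
pose FL : {linear U -> W} := HB.pack F (GRing.isLinear.Build _ _ _ _ F linF).
rewrite -[F]/(FL : U -> W) linear_sum.
by apply: eq_bigr => i _; rewrite linearZ.
Qed.

(** * Tangent vectors, tangent maps and bilinear forms in charts *)

Section TangentSpaces.
Variable R : realType.

Lemma smooth_map_id (m : nat) (M : manifold R m) : smooth_map (idfun : M -> M).
Proof. by split=> [x|c d ac ad]; [exact: cvg_id|exact: atlas_smooth]. Qed.

Lemma chart_cap_open (m n : nat) (M : manifold R m) (N : manifold R n)
    (f : M -> N) c d :
  continuous f -> open (chart_cap f c d).
Proof.
move=> cf; rewrite openE => y [cy dy].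
apply: filterI; first by apply: open_nbhs_nbhs; split=> //; exact: cod_open.
have cfc : {for y, continuous (f \o cinv c)}.
  by apply: continuous_comp; [exact: cinv_cont|exact: cf].
by apply: cfc; apply: open_nbhs_nbhs; split=> //; exact: dom_open.
Qed.

Lemma chart_cap_cmap (m n : nat) (M : manifold R m) (N : manifold R n)
    (f : M -> N) c d x :
  atlas_at x c -> atlas_at (f x) d -> chart_cap f c d (cmap c x).
Proof.
by move=> [_ cx] [_ dfx]; split; [exact: cmap_cod|rewrite cmapK].
Qed.

Lemma smooth_differentiable (m n : nat) (M : manifold R m) (N : manifold R n)
    (f : M -> N) c d y : smooth_map f -> atlas c -> atlas d ->
  chart_cap f c d y -> differentiable (fun y => cmap d (f (cinv c y))) y.
Proof. by move=> [_ sf] ac ad; have [] := sf _ _ ac ad 1%N; move=> + _; exact. Qed.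

(** Taking [f] or [g] to be the identity turns this chain rule into the change of charts in the
    source or in the target. *)
Lemma diff_chart_comp (m n p : nat) (M : manifold R m) (N : manifold R n)
    (P : manifold R p) (f : M -> N) (g : N -> P) c d e x u :
  smooth_map f -> smooth_map g ->
  atlas_at x c -> atlas_at (f x) d -> atlas_at (g (f x)) e ->
  'd (fun y => cmap e (g (f (cinv c y)))) (cmap c x) u =
  'd (fun y => cmap e (g (cinv d y))) (cmap d (f x))
     ('d (fun y => cmap d (f (cinv c y))) (cmap c x) u).
Proof.
move=> sf sg cx dfx egfx.
have Uy := chart_cap_cmap cx dfx.
have df := smooth_differentiable sf cx.1 dfx.1 Uy.
have dg := smooth_differentiable sg dfx.1 egfx.1 (chart_cap_cmap dfx egfx).
set F := fun y => cmap d (f (cinv c y)) in df *.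
set G := fun y => cmap e (g (cinv d y)) in dg *.
have Fx : F (cmap c x) = cmap d (f x) by rewrite /F cmapK //; exact: cx.2.
rewrite -Fx in dg *.
(* [cinv d] undoes [cmap d] only on [dom d], so the two expressions agree just where [f] lands in
   [dom d]. *)
have GF : {near cmap c x, G \o F =1 (fun y => cmap e (g (f (cinv c y))))}.
  have oU := chart_cap_open (c := c) (d := d) sf.1.
  apply: filterS (open_nbhs_nbhs (conj oU Uy)) => y [_ dy].
  by rewrite /G /F /= cmapK.
have [_ ->] := is_diff_near GF (differentiable_comp df dg).
by rewrite (diff_comp df dg).
Qed.

Lemma diff_chart_id (m : nat) (M : manifold R m) (c : chart R m M) (x : M) u :
  dom c x -> 'd (fun y => cmap c (cinv c y)) (cmap c x) u = u.
Proof.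
move=> cx.
have E : {near cmap c x, id =1 (fun y => cmap c (cinv c y))}.
  have : nbhs (cmap c x) (cod c).
    by apply: open_nbhs_nbhs; split; [exact: cod_open|exact: cmap_cod].
  by apply: filterS => y /cinvK.
have [_ ->] := is_diff_near E (ex_diff (df := id)).
by rewrite diff_val.
Qed.

Section OneManifold.
Variables (m : nat) (M : manifold R m).
Implicit Types (x : M) (c d : chart R m M) (u v w : tvec M).

Lemma tspace_lin x a u v : tspace x u -> tspace x v -> tspace x (a *: u + v).
Proof.
move=> [u0 ud] [v0 vd]; split=> [c cx|c d cx dx].
  by rewrite !fctE u0 // v0 // scaler0 addr0.
by rewrite !fctE (ud _ _ cx dx) (vd _ _ cx dx) linearP.
Qed.

Lemma tspace0 x : tspace x (0 : tvec M).
Proof. by split=> [//|c d cx dx]; exact: (esym (linear0 _)). Qed.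

Lemma tspaceZ x a u : tspace x u -> tspace x (a *: u).
Proof. by move=> xu; rewrite -[_ *: _]addr0; apply: tspace_lin => //; exact: tspace0. Qed.

Lemma tspaceB x u v : tspace x u -> tspace x v -> tspace x (u - v).
Proof. by move=> xu xv; rewrite addrC -scaleN1r; exact: tspace_lin. Qed.

Lemma tspace_sum x (I : Type) (r : seq I) (F : I -> tvec M) :
  (forall i, tspace x (F i)) -> tspace x (\sum_(i <- r) F i).
Proof.
move=> xF; elim: r => [|i r IH]; first by rewrite big_nil; exact: tspace0.
by rewrite big_cons -[F i]scale1r; exact: tspace_lin.
Qed.

(** The transformation law from [d] to [e] is the cocycle relation for the transitions from [c]
    through [d] to [e]. *)
Lemma coord_vec_tspace c x z : atlas_at x c -> tspace x (coord_vec c x z).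
Proof.
move=> cx; split=> [d|d e dx ex]; rewrite /coord_vec.
  by case: asboolP.
do 2!case: asboolP => // _.
exact: (diff_chart_comp (f := idfun) (g := idfun) z (smooth_map_id M) (smooth_map_id M)).
Qed.

Lemma coord_vec_comp c x z : atlas_at x c -> coord_vec c x z c = z.
Proof.
by move=> cx; rewrite /coord_vec; case: asboolP => // _; exact/diff_chart_id/(cx.2).
Qed.

Lemma coord_vecK c x u : atlas_at x c -> tspace x u -> coord_vec c x (u c) = u.
Proof.
move=> cx [u0 ud]; apply/funext => d; rewrite /coord_vec.
by case: asboolP => [dx|/u0 -> //]; rewrite -ud.
Qed.

Lemma coord_vec_lin c x a z1 z2 :
  coord_vec c x (a *: z1 + z2) = a *: coord_vec c x z1 + coord_vec c x z2.
Proof.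
apply/funext => d; rewrite /coord_vec !fctE.
by case: asboolP => _; rewrite ?linearP // scaler0 addr0.
Qed.

Lemma coord_vec_sum c x z :
  coord_vec c x z = \sum_i z 0 i *: coord_vec c x (basis_vec R i).
Proof.
rewrite {1}(row_sum_delta z); apply: (linear_fun_sum (F := coord_vec c x)).
exact: coord_vec_lin.
Qed.

(** Restricted to [tspace x], since a metric is unspecified elsewhere; it covers both $\overline g$
    and its pullback. *)
Definition bilinear_at x (B : tvec M -> tvec M -> R) :=
  forall a u v w, tspace x u -> tspace x v -> tspace x w ->
    B (a *: u + v) w = a * B u w + B v w /\
    B w (a *: u + v) = a * B w u + B w v.

Section Bilinear.
Variables (x : M) (B : tvec M -> tvec M -> R).
Hypothesis bilB : bilinear_at x B.

Lemma bilinear0l w : tspace x w -> B 0 w = 0.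
Proof.
move=> xw; have [+ _] := bilB 1 (tspace0 x) (tspace0 x) xw.
by rewrite scaler0 addr0 mul1r => B0; apply: (@addrI _ (B 0 w)); rewrite addr0 -B0.
Qed.

Lemma bilinear0r w : tspace x w -> B w 0 = 0.
Proof.
move=> xw; have [_ +] := bilB 1 (tspace0 x) (tspace0 x) xw.
by rewrite scaler0 addr0 mul1r => B0; apply: (@addrI _ (B w 0)); rewrite addr0 -B0.
Qed.

Lemma bilinearBl u v w : tspace x u -> tspace x v -> tspace x w ->
  B (u - v) w = B u w - B v w.
Proof.
move=> xu xv xw; have [+ _] := bilB (-1) xv xu xw.
by rewrite scaleN1r mulN1r addrC => ->; rewrite addrC.
Qed.

Lemma bilinearDl u v w : tspace x u -> tspace x v -> tspace x w ->
  B (u + v) w = B u w + B v w.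
Proof.
by move=> xu xv xw; have [+ _] := bilB 1 xu xv xw; rewrite scale1r mul1r.
Qed.

Lemma bilinearDr u v w : tspace x u -> tspace x v -> tspace x w ->
  B w (u + v) = B w u + B w v.
Proof.
by move=> xu xv xw; have [_ +] := bilB 1 xu xv xw; rewrite scale1r mul1r.
Qed.

Lemma bilinear_suml (I : Type) (r : seq I) (a : I -> R) (F : I -> tvec M) w :
  (forall i, tspace x (F i)) -> tspace x w ->
  B (\sum_(i <- r) a i *: F i) w = \sum_(i <- r) a i * B (F i) w.
Proof.
move=> xF xw; elim: r => [|i r IH]; first by rewrite !big_nil bilinear0l.
rewrite !big_cons; have [|-> _] := bilB (a i) (xF i) _ xw (v := \sum_(j <- r) a j *: F j).
  by apply: tspace_sum => j; exact: tspaceZ.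
by rewrite IH.
Qed.

Lemma bilinear_sumr (I : Type) (r : seq I) (a : I -> R) (F : I -> tvec M) w :
  (forall i, tspace x (F i)) -> tspace x w ->
  B w (\sum_(i <- r) a i *: F i) = \sum_(i <- r) a i * B w (F i).
Proof.
move=> xF xw; elim: r => [|i r IH]; first by rewrite !big_nil bilinear0r.
rewrite !big_cons; have [|_ ->] := bilB (a i) (xF i) _ xw (v := \sum_(j <- r) a j *: F j).
  by apply: tspace_sum => j; exact: tspaceZ.
by rewrite IH.
Qed.

(** The link from forms to Gram matrices, on which smoothness and invertibility are computed. *)
Lemma bilinear_coord c u v : atlas_at x c -> tspace x u -> tspace x v ->
  B u v = \sum_i u c 0 i * \sum_j v c 0 j *
    B (coord_vec c x (basis_vec R i)) (coord_vec c x (basis_vec R j)).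
Proof.
move=> cx xu xv; have xe i : tspace x (coord_vec c x (basis_vec R i)).
  exact: coord_vec_tspace.
rewrite -{1}(coord_vecK cx xu) [coord_vec c x (u c)]coord_vec_sum bilinear_suml //.
apply: eq_bigr => i _; rewrite -{1}(coord_vecK cx xv) [coord_vec c x (v c)]coord_vec_sum.
by rewrite bilinear_sumr.
Qed.

End Bilinear.

Lemma metric_bilinear (g : riemannian_metric M) x : bilinear_at x (g x).
Proof.
move=> a u v w xu xv xw; split; first exact: metric_linear.
rewrite Defs.metric_sym //; last exact: tspace_lin.
by rewrite metric_linear // (Defs.metric_sym g xu) // (Defs.metric_sym g xv).
Qed.

Lemma metric_eq0 (g : riemannian_metric M) x u :
  tspace x u -> g x u u = 0 -> u = 0.
Proof.
move=> xu gu; apply/eqP; apply/negPn/negP => /eqP u0.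
by have := metric_pos g xu u0; rewrite gu ltxx.
Qed.

End OneManifold.

(** * Smooth fields along a map, and their tangential projection *)

Section TwoManifolds.
Variables (m n : nat) (M : manifold R m) (N : manifold R n).
Implicit Types (f : M -> N) (h : M -> tvec N).

(** [tmap] is computed in the chosen chart [chart_at x]; the chain rule through the transition from
    [c] to that chart frees it of the choice. *)
Lemma tmapE f x v c d : smooth_map f -> atlas_at x c -> atlas_at (f x) d ->
  tspace x v ->
  tmap f x v d = 'd (fun y => cmap d (f (cinv c y))) (cmap c x) (v c).
Proof.
move=> sf cx dfx [_ xv]; rewrite /tmap; case: asboolP => // _.
have cx' : atlas_at x (chart_at x) := svalP (cid (atlas_cover x)).
rewrite [RHS](diff_chart_comp (f := idfun) (v c) (smooth_map_id M) sf cx cx' dfx).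
by rewrite (xv _ _ cx cx').
Qed.

Lemma tmap_tspace f x v : smooth_map f -> tspace x v -> tspace (f x) (tmap f x v).
Proof.
move=> sf xv; split=> [d|d e dx ex].
  by rewrite /tmap; case: asboolP.
have cx' : atlas_at x (chart_at x) := svalP (cid (atlas_cover x)).
rewrite !(tmapE sf cx' _ xv) //.
exact: (diff_chart_comp (g := idfun) _ sf (smooth_map_id N) cx' dx ex).
Qed.

Lemma tmap_lin f x a u v : tmap f x (a *: u + v) = a *: tmap f x u + tmap f x v.
Proof.
apply/funext => d; rewrite /tmap !fctE.
by case: asboolP => _; rewrite ?linearP // scaler0 addr0.
Qed.

Lemma tmap0 f x : tmap f x 0 = 0.
Proof.
by apply/funext => d; rewrite /tmap; case: asboolP => // _; exact: linear0.
Qed.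

Lemma smooth_along_lin f a h k : continuous f ->
  smooth_along f h -> smooth_along f k -> smooth_along f (a *: h + k).
Proof.
move=> cf [fh sh] [fk sk]; split=> [x|c d ac ad l].
  by apply: tspace_lin; [exact: fh|exact: fk].
have oU := chart_cap_open (c := c) (d := d) cf.
exact: (Ck_onD oU (Ck_onZ oU a (sh _ _ ac ad l)) (sk _ _ ac ad l)).
Qed.

Lemma smooth_along0 f : continuous f -> smooth_along f 0.
Proof.
move=> cf; split=> [x|c d ac ad l]; first exact: tspace0.
exact: (Ck_on_cst (chart_cap_open (c := c) (d := d) cf)).
Qed.

Lemma tangent_smooth_along f X : smooth_map f -> vector_fields X ->
  smooth_along f (fun x => tmap f x (X x)).
Proof.
move=> sf [xX sX]; split=> [x|c d ac ad k]; first exact/tmap_tspace/xX.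
have oU := chart_cap_open (c := c) (d := d) sf.1.
(* In charts the field is $\sum_i X^i\,\partial_i f$, so order $k$ costs one more derivative of
   [f]. *)
have [_ Cd] := sf.2 _ _ ac ad k.+1.
have CX : Ck_on k (chart_cap f c d) (fun y => X (cinv c y) c).
  by apply: Ck_on_sub (sX _ _ ac ac k) => y [cy _]; split=> //; exact: cinv_dom.
apply: (@Ck_on_eq _ _ _ _ _ (fun y => \sum_i X (cinv c y) c 0 i *:
   'd (fun y => cmap d (f (cinv c y))) y (basis_vec R i))) => //.
  move=> y [cy dy]; rewrite -diff_row (tmapE (c := c) sf) ?cinvK //.
  - by split=> //; exact: cinv_dom.
  - exact: xX.
apply: Ck_on_sum => // i; apply: Ck_on_row => // j.
apply: (@Ck_on_eq _ _ _ _ _ (fun y => X (cinv c y) c 0 i *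
   'd (fun y => cmap d (f (cinv c y))) y (basis_vec R i) 0 j : R^o)) => //.
  by move=> y _; rewrite !mxE.
by apply: Ck_onM => //; apply: Ck_on_coord => //; exact: Cd.
Qed.

Variable gbar : riemannian_metric N.

Lemma Ck_on_metric f c d k (h1 h2 : 'rV[R]_m -> tvec N) :
  smooth_map f -> atlas c -> atlas d ->
  (forall y, chart_cap f c d y -> tspace (f (cinv c y)) (h1 y)) ->
  (forall y, chart_cap f c d y -> tspace (f (cinv c y)) (h2 y)) ->
  Ck_on k (chart_cap f c d) (fun y => h1 y d) ->
  Ck_on k (chart_cap f c d) (fun y => h2 y d) ->
  Ck_on k (chart_cap f c d) (fun y => gbar (f (cinv c y)) (h1 y) (h2 y) : R^o).
Proof.
move=> sf ac ad f1 f2 C1 C2.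
have oU := chart_cap_open (c := c) (d := d) sf.1.
apply: (@Ck_on_eq _ _ _ _ _ (fun y => \sum_i h1 y d 0 i * \sum_j h2 y d 0 j *
    gram gbar d (cmap d (f (cinv c y))) i j : R^o)) => //.
  move=> y Uy; have dfy : atlas_at (f (cinv c y)) d by split=> //; exact: Uy.2.
  rewrite (bilinear_coord (@metric_bilinear _ _ gbar _) dfy (f1 _ Uy) (f2 _ Uy)).
  by do 2!(apply: eq_bigr => ? _; congr (_ * _)); rewrite mxE cmapK //; exact: Uy.2.
apply: Ck_on_sum => // i; apply: Ck_onM => //; first exact: (Ck_on_coord oU 0 i C1).
apply: Ck_on_sum => // j; apply: Ck_onM => //; first exact: (Ck_on_coord oU 0 j C2).
apply: (Ck_on_comp (U' := cod d) (F := fun y => cmap d (f (cinv c y)))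
  (G := fun z => gram gbar d z i j : R^o)) => //.
- by move=> y [_ dy]; exact: cmap_cod.
- exact: sf.2.
- exact: (metric_smooth gbar i j ad).
Qed.

Section Immersion.
Variable f : M -> N.
Hypothesis immf : immersion f.

Let smoothf : smooth_map f := immf.1.

Lemma pullback_bilinear x : bilinear_at x (pullback gbar f x).
Proof.
move=> a u v w xu xv xw; rewrite /pullback tmap_lin.
by apply: (@metric_bilinear _ _ gbar); exact: tmap_tspace.
Qed.

Lemma pullback_eq0 x u : tspace x u -> pullback gbar f x u u = 0 -> u = 0.
Proof.
move=> xu /metric_eq0 => /(_ (tmap_tspace smoothf xu)) u0.
have := @immf.2 x u 0; rewrite !inE tmap0 u0; apply=> //; exact: tspace0.
Qed.

(** A row [w] killed by the Gram matrix $G$ gives a tangent vector of squared length $w G w^T = 0$,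
    which vanishes because the pullback along an immersion is definite. *)
Lemma gram_unit c y : atlas c -> cod c y -> gram (pullback gbar f) c y \in unitmx.
Proof.
move=> ac cy; have cx : atlas_at (cinv c y) c by split=> //; exact: cinv_dom.
rewrite unitmxE unitfE; apply/negP => /det0P[w w0 wG].
have xw := coord_vec_tspace w cx.
suff /(congr1 (fun v => v c)) : coord_vec c (cinv c y) w = 0.
  by rewrite coord_vec_comp // => w00; rewrite w00 eqxx in w0.
apply: (pullback_eq0 xw).
rewrite (bilinear_coord (@pullback_bilinear _) cx xw xw) coord_vec_comp //.
under eq_bigr do rewrite mulr_sumr.
rewrite exchange_big /= big1 // => j _.
under eq_bigr do rewrite mulrCA.
rewrite -mulr_sumr.
have /rowP/(_ j) := wG; rewrite !mxE => wGj.
rewrite [X in _ * X](_ : _ = 0) ?mulr0 // -[RHS]wGj.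
by apply: eq_bigr => i _; rewrite mxE.
Qed.

(* The coordinates of the vector whose image under [T_x f] is the orthogonal
   projection of [h x] to the image of [T_x f]. *)
Definition tangential_coord h (c : chart R m M) (x : M) : 'rV[R]_m :=
  (\row_j gbar (f x) (h x) (tmap f x (coord_vec c x (basis_vec R j))))
  *m invmx (gram (pullback gbar f) c (cmap c x)).

(** A chart-free characterization of the projection, which allows solutions computed in different
    charts to be compared. *)
Definition tangential_at h (x : M) (u : tvec M) :=
  tspace x u /\ forall w, tspace x w ->
    gbar (f x) (tmap f x u) (tmap f x w) = gbar (f x) (h x) (tmap f x w).

Lemma tangential_coordP h c x : tspace (f x) (h x) -> atlas_at x c ->
  tangential_at h x (coord_vec c x (tangential_coord h c x)).
Proof.
move=> fh cx; have xe i := coord_vec_tspace (basis_vec R i) cx.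
split=> [|w xw]; first exact: coord_vec_tspace.
rewrite -[LHS]/(pullback gbar f x _ w).
rewrite (bilinear_coord (@pullback_bilinear _) cx (coord_vec_tspace _ cx) xw).
rewrite coord_vec_comp //.
transitivity (\sum_j w c 0 j * gbar (f x) (h x) (tmap f x (coord_vec c x (basis_vec R j)))).
  under eq_bigr do rewrite mulr_sumr.
  rewrite exchange_big /=; apply: eq_bigr => j _.
  under eq_bigr do rewrite mulrCA.
  rewrite -mulr_sumr; congr (_ * _).
  (* On a basis vector the claim reads $(r G^{-1}) G = r$, with $r$ the row of products of [h x]
     with the $\partial_j f$. *)
  have /rowP/(_ j) := mulmxKV (gram_unit cx.1 (cmap_cod cx.2))
    (\row_j gbar (f x) (h x) (tmap f x (coord_vec c x (basis_vec R j)))).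
  rewrite -/(tangential_coord h c x) [RHS]mxE => <-; rewrite mxE.
  by apply: eq_bigr => i _; congr (_ * _); rewrite mxE cmapK //; exact: cx.2.
rewrite -[X in tmap f x X](coord_vecK cx xw) [coord_vec c x (w c)]coord_vec_sum.
rewrite (linear_fun_sum _ _ _ (tmap_lin f x)).
rewrite (bilinear_sumr (@metric_bilinear _ _ gbar _)) // => i.
exact: tmap_tspace.
Qed.

Lemma tangential_unique h x u v :
  tspace (f x) (h x) -> tangential_at h x u -> tangential_at h x v -> u = v.
Proof.
move=> fh [xu hu] [xv hv]; have xuv := tspaceB xu xv.
apply/subr0_eq/(pullback_eq0 xuv).
rewrite (bilinearBl (@pullback_bilinear _)) //.
by rewrite /pullback hu // hv // subrr.
Qed.

Lemma Ck_on_tangential_coord h c k : smooth_along f h -> atlas c ->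
  Ck_on k (cod c) (fun y => tangential_coord h c (cinv c y)).
Proof.
(* Localizing lets [f] take its values in a single chart [d] of [N], where $\overline g$ and [h]
   have smooth components. *)
move=> [fh sh] ac; apply: Ck_on_local => y0 cy0.
have [d [ad dx]] := atlas_cover (f (cinv c y0)).
exists (chart_cap f c d); first by split.
have oU := chart_cap_open (c := c) (d := d) smoothf.1.
have cx y : chart_cap f c d y -> atlas_at (cinv c y) c.
  by move=> [cy _]; split=> //; exact: cinv_dom.
(* [P j] is the coordinate field $\partial_j f$ along [f]. *)
pose P j y := tmap f (cinv c y) (coord_vec c (cinv c y) (basis_vec R j)).
have fP j y : chart_cap f c d y -> tspace (f (cinv c y)) (P j y).
  by move=> Uy; apply: tmap_tspace => //; exact/coord_vec_tspace/cx.
have CP j : Ck_on k (chart_cap f c d) (fun y => P j y d).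
  have [_ Cd] := smoothf.2 _ _ ac ad k.+1.
  apply: Ck_on_eq (Cd (basis_vec R j)) => // y Uy.
  have cxy := cx _ Uy.
  have dfy : atlas_at (f (cinv c y)) d by split=> //; exact: Uy.2.
  rewrite /P (tmapE smoothf cxy dfy (coord_vec_tspace _ cxy)).
  by rewrite (coord_vec_comp _ cxy) (cinvK Uy.1).
apply: Ck_on_row => // j.
apply: (@Ck_on_eq _ _ _ _ _ (fun y => \sum_i gbar (f (cinv c y)) (h (cinv c y)) (P i y) *
   invmx (gram (pullback gbar f) c y) i j : R^o)) => //.
  move=> y Uy; rewrite mxE cinvK; last exact: Uy.1.
  by apply: eq_bigr => i _; rewrite mxE.
apply: Ck_on_sum => // i; apply: Ck_onM => //.
  apply: (Ck_on_metric (h1 := fun y => h (cinv c y))) => //.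
  - by move=> y; exact: fP.
  - exact: sh.
apply: Ck_on_invmx => // [y Uy|i' j']; first exact: (gram_unit ac Uy.1).
apply: (@Ck_on_eq _ _ _ _ _ (fun y => gbar (f (cinv c y)) (P i' y) (P j' y) : R^o)) => //.
  by move=> y _; rewrite mxE.
by apply: Ck_on_metric => //; exact: fP.
Qed.

Lemma tangential_vector_field h : smooth_along f h ->
  exists2 X, vector_fields X & forall x, tangential_at h x (X x).
Proof.
move=> sh.
(* The values are chosen point by point; uniqueness then identifies them in each chart with the
   smooth [tangential_coord], so the chosen field is smooth. *)
have /choice[X hX] : forall x, exists u, tangential_at h x u.
  move=> x; have [c cx] := atlas_cover x.
  by eexists; apply: (tangential_coordP _ cx); exact: sh.1.
exists X => //; split=> [x|c d ac ad k]; first by have [] := hX x.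
have oU := chart_cap_open (c := c) (d := d) (smooth_map_id M).1.
have XE x : dom d x -> X x d = tangential_coord h d x.
  move=> dx; have adx : atlas_at x d by [].
  have := tangential_unique (sh.1 x) (hX x) (tangential_coordP (sh.1 x) adx).
  by move=> ->; rewrite coord_vec_comp.
apply: Ck_on_row => // j.
apply: (@Ck_on_eq _ _ _ _ _ ((fun z => tangential_coord h d (cinv d z) 0 j : R^o) \o
    (fun y => cmap d (cinv c y)))) => //.
  by move=> y [_ dy]; rewrite /= cmapK // XE.
apply: (Ck_on_comp (U' := cod d)) => //.
- by move=> y [_ dy]; exact: cmap_cod.
- exact: (atlas_smooth ac ad).
- exact: (Ck_on_coord (@cod_open _ _ _ d) 0 j (Ck_on_tangential_coord k sh ad)).
Qed.

Lemma Tan_Nor_decomposition h : smooth_along f h ->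
  exists t n, [/\ Tan f t, Nor gbar f n & h = t + n].
Proof.
move=> sh; have [X vX hX] := tangential_vector_field sh.
have st := tangent_smooth_along smoothf vX.
exists (fun x => tmap f x (X x)), (h - fun x => tmap f x (X x)).
split; [by exists X| |by rewrite addrC subrK].
split=> [|_ [Y vY <-] x].
  by rewrite addrC -scaleN1r; apply: smooth_along_lin => //; exact: smoothf.1.
have [tX tXE] := hX x; have xY := vY.1 x.
(* By the choice of [X], [h] and its tangential part have the same product with every $Tf\circ
   Y$. *)
rewrite !fctE (bilinearBl (@metric_bilinear _ _ gbar _)) ?tXE ?subrr //.
- exact: sh.1.
- exact: tmap_tspace.
- exact: tmap_tspace.
Qed.

End Immersion.
End TwoManifolds.
End TangentSpaces.

(** * The two splittings and the operator $L$ *)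

Section Splitting.
Variables (R : realType) (m n : nat) (M : manifold R m) (N : manifold R n).
Variables (gbar : riemannian_metric N).
Implicit Types (f : M -> N) (h k t : M -> tvec N).

Lemma linear_operator0 (S : set (M -> tvec N)) A :
  S 0 -> linear_operator_on S A -> A 0 = 0.
Proof.
move=> S0 [_ /(_ 1 0 0 S0 S0)].
by rewrite !scale1r addr0 => A0; apply: (@addrI _ (A 0)); rewrite addr0 -A0.
Qed.

Lemma linear_operatorD (S : set (M -> tvec N)) A h k :
  linear_operator_on S A -> S h -> S k -> A (h + k) = A h + A k.
Proof. by move=> [_ linA] Sh Sk; have := linA 1 h k Sh Sk; rewrite !scale1r. Qed.

Section AtImmersion.
Variable f : M -> N.
Hypothesis immf : immersion f.

Let smoothf : smooth_map f := immf.1.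

Lemma Tan_smooth_along t : Tan f t -> smooth_along f t.
Proof. by move=> [X vX <-]; exact: tangent_smooth_along. Qed.

Lemma Tan0 : Tan f 0.
Proof.
exists 0; first by apply: smooth_along0; exact: (smooth_map_id M).1.
by apply/funext => x; exact: tmap0.
Qed.

Lemma Nor0 : Nor gbar f 0.
Proof.
split=> [|t /Tan_smooth_along[ft _] x]; first exact: smooth_along0 smoothf.1.
exact: (bilinear0l (@metric_bilinear _ _ _ gbar _) (ft x)).
Qed.

Lemma smooth_alongD h k :
  smooth_along f h -> smooth_along f k -> smooth_along f (h + k).
Proof.
move=> sh sk; rewrite -[h]scale1r; exact: (smooth_along_lin 1 smoothf.1 sh sk).
Qed.

Lemma metric_Nor_Tan h t x : Nor gbar f h -> Tan f t -> gbar (f x) (h x) (t x) = 0.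
Proof. by move=> [_ nh] Tt; exact: nh. Qed.

Lemma metric_Tan_Nor h t x : Nor gbar f h -> Tan f t -> gbar (f x) (t x) (h x) = 0.
Proof.
move=> nh Tt; rewrite Defs.metric_sym ?(metric_Nor_Tan _ nh Tt) //.
  by have [] := Tan_smooth_along Tt.
by have [[]] := nh.
Qed.

Lemma Tan_Nor_eq0 t : Tan f t -> Nor gbar f t -> t = 0.
Proof.
move=> Tt nt; apply/funext => x.
apply: (@metric_eq0 _ _ _ gbar (f x)); first by have [[]] := nt.
exact: metric_Nor_Tan.
Qed.

Lemma Tan_Nor_direct_sum :
  direct_sum (smooth_along f) (Tan f) (Nor gbar f).
Proof.
split; apply/seteqP; split=> h.
- move=> /(Tan_Nor_decomposition gbar immf)[t [k [Tt nk ->]]].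
  by exists t => //; exists k.
- by move=> [t /Tan_smooth_along st [k [sk _] <-]]; exact: smooth_alongD.
- by move=> [Tt nt]; exact: Tan_Nor_eq0.
- by move=> ->; split; [exact: Tan0|exact: Nor0].
Qed.

Variable vol : (M -> N) -> {measure set (borel M) -> \bar R}.

Lemma eq_GL2 h k h' k' :
  (forall x, gbar (f x) (h x) (k x) = gbar (f x) (h' x) (k' x)) ->
  GL2 gbar vol f h k = GL2 gbar vol f h' k'.
Proof. by move=> hk; rewrite /GL2; congr (Rintegral _ _ _); apply/funext. Qed.

Lemma GL2_eq0 h k :
  (forall x, gbar (f x) (h x) (k x) = 0) -> GL2 gbar vol f h k = 0.
Proof.
move=> hk; rewrite /GL2 /Rintegral.
by under eq_integral do rewrite hk; rewrite integral0.
Qed.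

(** Both integrands equal $\overline g(a,c)$ pointwise: the tangential projection is symmetric, and
    neither integral has to be split. *)
Lemma GL2_Tan_proj a b c d :
  Tan f a -> Nor gbar f b -> Tan f c -> Nor gbar f d ->
  GL2 gbar vol f a (c + d) = GL2 gbar vol f (a + b) c.
Proof.
move=> Ta nb Tc nd; apply: eq_GL2 => x; rewrite !fctE.
have [fa _] := Tan_smooth_along Ta; have [fc _] := Tan_smooth_along Tc.
have [[fb _] _] := nb; have [[fd _] _] := nd.
have bg := @metric_bilinear _ _ _ gbar (f x).
rewrite (bilinearDr bg (fc x) (fd x) (fa x)) (bilinearDl bg (fa x) (fb x) (fc x)).
by rewrite (metric_Tan_Nor _ nd Ta) (metric_Nor_Tan _ nb Tc).
Qed.

Lemma GL2_Nor_proj a b c d :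
  Tan f a -> Nor gbar f b -> Tan f c -> Nor gbar f d ->
  GL2 gbar vol f b (c + d) = GL2 gbar vol f (a + b) d.
Proof.
move=> Ta nb Tc nd; apply: eq_GL2 => x; rewrite !fctE.
have [fa _] := Tan_smooth_along Ta; have [fc _] := Tan_smooth_along Tc.
have [[fb _] _] := nb; have [[fd _] _] := nd.
have bg := @metric_bilinear _ _ _ gbar (f x).
rewrite (bilinearDr bg (fc x) (fd x) (fb x)) (bilinearDl bg (fa x) (fb x) (fd x)).
by rewrite (metric_Tan_Nor _ nd Ta) (metric_Nor_Tan _ nb Tc) add0r.
Qed.

Variable L : fiber_map M N.
Hypothesis Llin : linear_operator_on (smooth_along f) (L f).
Hypothesis Lpos : L2_positive gbar vol L.

Lemma Hor_eq_Nor :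
  (forall h, Nor gbar f h -> Nor gbar f (L f h)) ->
  (forall t, Tan f t -> Tan f (L f t)) ->
  Hor gbar vol L f = Nor gbar f.
Proof.
move=> LN LT; apply/seteqP; split=> [h [sh hV]|h nh]; last first.
  split=> [|t Tt]; first by have [] := nh.
  by apply: GL2_eq0 => x; apply: metric_Nor_Tan => //; exact: LN.
have [a [b [Ta nb hE]]] := Tan_Nor_decomposition gbar immf sh.
suff a0 : a = 0 by rewrite hE a0 add0r.
apply/eqP/negPn/negP => /eqP a0.
have sa := Tan_smooth_along Ta; have [sb _] := nb.
have := Lpos immf sa a0.
(* Pairing with [a + 0] lets the projection lemma trade [L f a] for [L f a + L f b], which is
   [L f h]. *)
rewrite -[X in GL2 _ _ _ _ X]addr0 (GL2_Tan_proj (LT _ Ta) (LN _ nb) Ta Nor0).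
rewrite -(linear_operatorD Llin sa sb) -hE.
by rewrite -/(GL _ _ _ _ _ _) (hV _ Ta) ltxx.
Qed.

Variable L' : fiber_map M N.
Hypothesis L'smooth : forall h, smooth_along f h -> smooth_along f (L' f h).
Hypothesis LL'K : forall h, smooth_along f h -> L f (L' f h) = h.
Hypothesis Lsym : L2_symmetric gbar vol L.
Hypothesis HorNor : Hor gbar vol L f = Nor gbar f.

(* Positivity of [L] at [L' f h]: this replaces the nondegeneracy of the
   [L2]-metric, so that no integral has to be estimated. *)
Lemma GL2_inv_eq0 h : smooth_along f h -> GL2 gbar vol f h (L' f h) = 0 -> h = 0.
Proof.
move=> sh h0; suff L'h0 : L' f h = 0.
  by rewrite -(LL'K sh) L'h0 (linear_operator0 _ Llin) //; exact: smooth_along0 smoothf.1.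
apply/eqP/negPn/negP => /eqP /(Lpos immf (L'smooth sh)).
by rewrite LL'K // h0 ltxx.
Qed.

Lemma L_Nor h : Nor gbar f h -> Nor gbar f (L f h).
Proof.
move=> nh; have [sh _] := nh.
have [a [b [Ta nb LhE]]] := Tan_Nor_decomposition gbar immf (Llin.1 _ sh).
suff a0 : a = 0 by rewrite LhE a0 add0r.
have sa := Tan_smooth_along Ta.
have [c [d [Tc nd cE]]] := Tan_Nor_decomposition gbar immf (L'smooth sa).
apply: GL2_inv_eq0 => //; rewrite cE (GL2_Tan_proj Ta nb Tc nd) -LhE.
(* By [HorNor] the normal field [h] is horizontal, and [c] is vertical. *)
by move: nh; rewrite -HorNor => -[_]; exact.
Qed.

Lemma L_Tan t : Tan f t -> Tan f (L f t).
Proof.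
move=> Tt; have st := Tan_smooth_along Tt.
have [a [b [Ta nb LtE]]] := Tan_Nor_decomposition gbar immf (Llin.1 _ st).
suff b0 : b = 0 by rewrite LtE b0 addr0.
have [sb _] := nb.
have [c [d [Tc nd cE]]] := Tan_Nor_decomposition gbar immf (L'smooth sb).
apply: GL2_inv_eq0 => //; rewrite cE (GL2_Nor_proj Ta nb Tc nd) -LtE.
(* Symmetry moves [L] onto the normal field [d]; its image is normal by [L_Nor], so the integrand
   vanishes. *)
have [sd _] := nd; rewrite Lsym //.
by apply: GL2_eq0 => x; apply: metric_Tan_Nor => //; exact: L_Nor.
Qed.

End AtImmersion.
End Splitting.

Theorem theorem3 (R : realType) (m n : nat) (M : manifold R m)
    (N : manifold R n) (gbar : riemannian_metric N)
    (vol : (M -> N) -> {measure set (borel M) -> \bar R})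
    (l : R) (L : fiber_map M N)
    (Mcompact : compact [set: M])
    (le_mn : (m <= n)%N)
    (Nbounded : bounded_geometry gbar)
    (volP : forall f, immersion f -> is_volume (pullback gbar f) (vol f))
    (Lauto : smooth_bundle_automorphism L)
    (Lpdo : forall f, immersion f -> pseudo_differential (2 * l) f (L f))
    (Lsym : L2_symmetric gbar vol L)
    (Lpos : L2_positive gbar vol L)
    (Lequiv : Diff_equivariant L) :
  (forall f : M -> N, immersion f ->
     [/\ direct_sum (smooth_along f) (Ver f) (Hor gbar vol L f),
         Ver f = Tan f
       & Hor gbar vol L f = Nor gbar f])
  <->
  (exists LNor LTan : fiber_map M N, decomposes gbar L LNor LTan).
Proof.
have [[Llin _] [L' [[L'lin _] LL'K]]] := Lauto; split=> [split_eq|[LNor [LTan dec]] f immf].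
  (* Both blocks are [L] itself, since [decomposes] looks at them only on [Nor f] and [Tan f]. *)
  exists L, L => f immf; have [_ _ HN] := split_eq f immf.
  have L's h : smooth_along f h -> smooth_along f (L' f h).
    exact: (L'lin f immf).1.
  have LL' h : smooth_along f h -> L f (L' f h) = h.
    by move=> sh; have [] := LL'K f h immf sh.
  split.
  - split=> [h|a h k [sh _] [sk _]]; last exact: (Llin f immf).2.
    exact: (L_Nor immf (Llin f immf) Lpos L's LL' HN).
  - split=> [h|a h k /(Tan_smooth_along immf) sh /(Tan_smooth_along immf) sk].
      exact: (L_Tan immf (Llin f immf) Lpos L's LL' Lsym HN).
    exact: (Llin f immf).2.
  - move=> h k [sh _] /(Tan_smooth_along immf) sk.
    exact: (linear_operatorD (Llin f immf)).
have [lN lT LE] := dec f immf.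
have N0 := Nor0 gbar immf; have T0 := @Tan0 _ _ _ M N f.
(* Setting one summand to 0 in the decomposition shows that [L] agrees with each block on its
   subspace, hence preserves it. *)
have LN h : Nor gbar f h -> Nor gbar f (L f h).
  move=> nh; rewrite -[h]addr0 LE // (linear_operator0 T0 lT) addr0.
  exact: lN.1.
have LT t : Tan f t -> Tan f (L f t).
  move=> Tt; rewrite -[t]add0r LE // (linear_operator0 N0 lN) add0r.
  exact: lT.1.
have HN := Hor_eq_Nor immf (Llin f immf) Lpos LN LT.
by split=> //; rewrite HN; exact: Tan_Nor_direct_sum immf.
Qed.
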